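(* There exists an absolute constant $\gamma>0$ such that every triangle-free graph on $n$ vertices with at least $\left(\frac15-\gamma\right)n^2$ edges contains a set of $\lfloor n/2\rfloor$ vertices that spans at most $n^2/50$ edges. *)

(* Defs.v *)
From HB Require Import structures.
From mathcomp Require Import all_boot all_order all_algebra.
From mathcomp Require Import reals.

Set Implicit Arguments.
Unset Strict Implicit.
Unset Printing Implicit Defensive.

Definition simple_graph (V : finType) (adj : rel V) : Prop :=
  symmetric adj /\ irreflexive adj.

Definition triangle_free (V : finType) (adj : rel V) : Prop :=
  forall x y z : V, ~ [/\ adj x y, adj y z & adj x z].

(* Edges are unordered pairs, so that each edge is counted once. *)
Definition edges (V : finType) (adj : rel V) : {set {set V}} :=
  [set [set x; y] | x in V, y in V & adj x y].

Definition spanned_edges (V : finType) (adj : rel V) (S : {set V}) :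
    {set {set V}} :=
  [set E in edges adj | E \subset S].

(* Main.v *)
Require Import Defs.
From HB Require Import structures.
From mathcomp Require Import all_boot all_order all_algebra.
From mathcomp Require Import reals.
From mathcomp Require Import zify ring lra.

Set Implicit Arguments.
Unset Strict Implicit.
Unset Printing Implicit Defensive.

Import Order.TTheory GRing.Theory Num.Theory.
Local Open Scope ring_scope.

(** Let [I] be a maximum independent set, and [a] its size.

    If [a >= 2n/5], let [S] be the set of vertices outside [I] with at most [a/2]
    neighbours in [I]; the remaining vertices outside [I] are independent, so
    [|S| >= n - 2a], and [I] together with any [n/2 - a] vertices of [S] is a
    candidate half.  If no candidate works, then vertices of [S] have close to
    [a/2] neighbours in [I] and no vertex has [n/2 - a] neighbours in [S].
    Hence the neighbours of [S] outside [I] and [S] have degree well below [a],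
    which is a bound for all degrees, and there are too few edges.

    If [a < 2n/5], all degrees are below [2n/5], so the edge count makes almost
    all degrees nearly [2n/5].  A 5-cycle of such vertices exists, its
    neighbourhoods cover almost everything, and the graph is a blow-up of the
    5-cycle up to few edges at each vertex.  Averaging over the five halves made
    of classes [i], [i + 2] and a part of class [i + 3] then suffices: a wrong
    edge [xy] forces [x] and [y] to miss linearly many of the expected edges. *)

(** * Real inequalities for the two cases *)

(** Here [al] is [a/n], and [ta] is [1/n] times the average number of neighbours in [I] of a vertex
    of [S]. Eliminating [ta] from the last two hypotheses leaves a cubic inequality that fails on
    [[2/5, 413/1000]]. *)
Lemma unit_arith (R : realFieldType) (al ta e : R) :
  2/5 <= al -> al < 1/2 -> ta <= al/2 -> e <= 1/1000 ->
  1 - 25/2 * (1/2 - al)^+2 < 50 * (1/2 - al) * ta ->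
  (3/2*al-1/2)^+2 - al/2*(al/2-ta) <= al-2/5+e -> False.
Proof.
move=> h1 h4 h5 h6 h7 h8.
(* With [ta <= al/2], [h7] becomes [1 < 25/2 * (1/4 - al^2)], that is [al^2 < 17/100]. *)
have hal : al <= 413/1000 by nra.
have [d [d0 d1 dE]] : exists d, [/\ 0 <= d, d <= 13/1000 & al = 2/5 + d].
  by exists (al - 2/5); split; lra.
have k1 : (1/2-al) * ((3/2*al-1/2)^+2 - al/2*(al/2)) * 50
    + al/2*(1 - 25/2 * (1/2-al)^+2) < 50*(1/2-al)*(al-2/5+e).
  have : al/2 * (1 - 25/2 * (1/2 - al)^+2) < al/2 * (50 * (1/2 - al) * ta).
    by rewrite ltr_pM2l //; lra.
  have : (1/2-al) * ((3/2*al-1/2)^+2 - al/2*(al/2-ta))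
      <= (1/2-al)*(al-2/5+e).
    by rewrite ler_pM2l //; lra.
  by lra.
have k2 : (1/2-al)*e <= (1/2-al) * (1/1000) by rewrite ler_pM2l //; lra.
have k3 : (1/2-al) * ((3/2*al-1/2)^+2 - al/2*(al/2)) * 50
    + al/2*(1 - 25/2 * (1/2-al)^+2) < 50*(1/2-al)*(al-2/5+1/1000) by lra.
move: k3; rewrite dE => {k1 k2 h8 h7 dE}.
have d2 : 0 <= d ^+ 2 by rewrite sqr_ge0.
have d3 : 0 <= d ^+ 3 by rewrite exprn_ge0.
nra.
Qed.

Lemma large_indep_arith (R : realFieldType) (n a k s T DB DS e : R) :
  0 < n -> 0 < k -> 2 * n <= 5 * a -> 2 * a + 2 * k <= n -> n - 2 * a <= s ->
  2 * T <= s * a -> 0 <= DS -> e <= 1/1000 ->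
  s * (n ^+ 2 - 25/2 * k ^+ 2) < 50 * k * T ->
  s * ((3/2*a - n/2) ^+ 2) - a/2 * (s * a/2 - T) - (3/2*a - n/2) * DS <= s * DB ->
  DS + DB <= a * n - (2/5 - e) * n ^+ 2 -> False.
Proof.
move=> n0 k0 h1 h2 h3 h4 h5 h6 h7 h8 h9.
have s0 : 0 < s by lra.
have n2 : 0 < n ^+ 2 by rewrite exprn_gt0.
set al := a / n; set ka := k / n; set ta := T / s / n; set sg := s / n.
have aE : a = al * n by rewrite /al; field; lra.
have kE : k = ka * n by rewrite /ka; field; lra.
have sE : s = sg * n by rewrite /sg; field; lra.
have TE : T = ta * s * n by rewrite /ta; field; lra.
have al1 : 2/5 <= al by rewrite -(ler_pM2r n0) -aE; lra.
have ka0 : 0 < ka by rewrite -(ltr_pM2r n0) -kE mul0r.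
have alka : al + ka <= 1/2 by rewrite -(ler_pM2r n0) mulrDl -aE -kE; lra.
have tal : ta <= al / 2.
  have sn : 0 < s * n by rewrite mulr_gt0.
  rewrite -(ler_pM2r sn).
  have -> : ta * (s * n) = T by rewrite TE; ring.
  have -> : al / 2 * (s * n) = s * a / 2 by rewrite aE; ring.
  lra.
have g7 : 1 - 25/2 * ka ^+ 2 < 50 * ka * ta.
  have sn : 0 < s * n ^+ 2 by rewrite mulr_gt0.
  rewrite -(ltr_pM2r sn); move: h7; rewrite TE kE.
  by congr (_ < _); ring.
have ta0 : 0 <= ta.
  have : 0 < 50 * ka * ta by apply: le_lt_trans g7; nra.
  rewrite pmulr_rgt0; [exact: ltW | lra].
have g8 : 1 - 25/2 * (1/2 - al) ^+ 2 < 50 * (1/2 - al) * ta.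
  apply: le_lt_trans (lt_le_trans g7 _); nra.
apply: (@unit_arith _ al ta e) => //; first by lra.
have al2 : al <= 413/1000 by nra.
rewrite -(ler_pM2r n2).
(* This holds because [413/1000 < 3/7]; it lets [s] replace the coefficient of [DS]. *)
have sg1 : n - 2 * a >= (3/2 * a - n/2) by rewrite aE; nra.
have g10 : s * (((3/2*al-1/2)^+2 - al/2*(al/2-ta)) * n^+2) <= s * (DS + DB).
  have -> : s * (((3/2*al-1/2)^+2 - al/2*(al/2-ta)) * n^+2)
      = s * ((3/2*a - n/2) ^+ 2) - a/2 * (s * a/2 - T).
    by rewrite TE aE; field.
  have : 0 <= (s - (3/2 * a - n/2)) * DS by apply: mulr_ge0 => //; lra.
  lra.
move: g10; rewrite ler_pM2l // => g10; apply: le_trans g10 (le_trans h9 _).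
rewrite aE; lra.
Qed.

(** When [xi < i], use [b >= (a - i - xi) - (a - d)]. The concave function [(a - i - xi) * (i - xi)]
    of [i] lies above its chord from [0] to [a/2], and the chord gives a bound linear in [i] and
    [d], which can be summed over [S]. *)
Lemma deficit_arith (R : realFieldType) (a xi i b sg d D : R) :
  0 <= xi -> xi <= a / 2 -> i <= a / 2 -> sg <= xi -> 0 <= a - d -> 0 <= D ->
  d = i + b + sg -> b * (i - xi) <= D ->
  (a/2 - xi) ^+ 2 - a/2 * (a/2) + a/2 * i - (a/2 - xi) * (a - d) <= D.
Proof.
move=> xi0 xia ia sgx d0 D0 dE bD.
have [ixi|xii] := lerP i xi.
  have : 0 <= (a/2 - xi) * (a - d) by apply: mulr_ge0; lra.
  have : 0 <= a/2 * (xi - i) by apply: mulr_ge0; lra.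
  have : 0 <= xi * (a/2 - xi) by apply: mulr_ge0; lra.
  lra.
have h1 : 0 <= (i - xi) * (xi - sg) by apply: mulr_ge0; lra.
have h2 : 0 <= (a/2 - i) * (a - d) by apply: mulr_ge0; lra.
have h3 : 0 <= (a/2 - i) * i by apply: mulr_ge0; lra.
apply: le_trans bD; have -> : b = d - i - sg by lra.
lra.
Qed.

(** As [m <= w2 * w3], [k] may be raised to [xi]; then each missing pair saves
    [xi / w3 >= 8/21 > 38/100]. *)
Lemma candidate_arith (R : realFieldType) (n w2 w3 k xi m G : R) :
  0 < n -> 0 <= k -> k <= xi -> 8/100 * n <= xi -> 0 < w3 -> 100 * w3 <= 21 * n ->
  0 <= m -> m <= w2 * w3 -> w3 * G + k * m <= k * (w2 * w3) ->
  G <= xi * w2 - 38/100 * m.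
Proof.
move=> n0 k0 kxi xin w30 w3n m0 mw h; rewrite -(ler_pM2l w30).
have h1 : 0 <= (xi - k) * (w2 * w3 - m) by apply: mulr_ge0; lra.
have h2 : 0 <= (xi - 38/100 * w3) * m by apply: mulr_ge0; lra.
lra.
Qed.

(** * Cyclic sums and the 5-cycle on ['I_5] *)

Lemma sum_shift5 (M : nmodType) (F : 'I_5 -> M) (j : 'I_5) :
  \sum_i F (i + j) = \sum_i F i.
Proof. by rewrite [RHS](reindex_inj (addIr j)). Qed.

(** Each summand counts the edges, in a weighted blow-up of the 5-cycle, of the half made of classes
    [i], [i + 2] and part of class [i + 3]. The best of the five halves thus has at most
    [n^2/50]. *)
Lemma pentagon_weights (R : realFieldType) (n : R) (w : 'I_5 -> R) :
  \sum_i w i = n ->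
  \sum_i (n / 2 - w i - w (i + 2)) * w (i + 2) <= n ^+ 2 / 10.
Proof.
move=> sw; have sw2 : \sum_i w (i + 2) = n by rewrite sum_shift5.
have sq2 : \sum_i w (i + 2) ^+ 2 = \sum_i w i ^+ 2.
  exact: (sum_shift5 (fun i => w i ^+ 2)).
(* Twice the left-hand side is [n^2] minus [sum_i (w i + w (i + 2))^2]. *)
have : 0 <= \sum_i (w i + w (i + 2) - 2 / 5 * n) ^+ 2.
  by apply: sumr_ge0 => i _; rewrite sqr_ge0.
have -> : \sum_i (w i + w (i + 2) - 2 / 5 * n) ^+ 2 =
  \sum_i (w i ^+ 2 - w (i + 2) ^+ 2 + (n - 4/5 * n) * w (i + 2)
   + (4 / 25 * n ^+ 2 - 4/5*n * w i)
   - 2 * ((n / 2 - w i - w (i + 2)) * w (i + 2))).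
  by apply: eq_bigr => i _; field.
rewrite !big_split /= !sumrN sq2 -!mulr_sumr sw2 sw sumr_const card_ord.
rewrite -(mulr_natl n 5); lra.
Qed.

Lemma sum5 (M : nmodType) (F : 'I_5 -> M) :
  \sum_i F i = F 0 + F 1 + F 2 + F 3 + F 4.
Proof.
rewrite !big_ord_recr big_ord0 /= add0r.
by congr (F _ + F _ + F _ + F _ + F _); apply: val_inj.
Qed.

Lemma sum5_from (M : nmodType) (F : 'I_5 -> M) i :
  \sum_j F j = F i + (F (i + 1) + F (i + 3)) + (F (i + 2) + F (i + 4)).
Proof.
rewrite -(sum_shift5 F i) sum5 /= add0r ![_ + i]addrC -!addrA.
by congr (_ + (_ + _)); rewrite addrCA.
Qed.

Ltac ord5 i := case: i => [[|[|[|[|[|//]]]]] ?].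

Definition near (i j : 'I_5) : bool := (j == i + 1) || (j == i - 1).

Lemma nearC i j : near i j = near j i.
Proof. by ord5 i; ord5 j. Qed.

(** The 5-cycle has diameter two, and equal indices also share a neighbour. This is what turns a
    wrong edge into forbidden triangles. *)
Lemma near_common i j : ~~ near i j -> exists2 l, near i l & near j l.
Proof.
move=> h.
suff : near i (i + 1) && near j (i + 1) || near i (i - 1) && near j (i - 1).
  by case/orP=> /andP[]; [exists (i + 1) | exists (i - 1)].
by move: h; ord5 i; ord5 j.
Qed.

(** * Degrees, edge counts and halves in a triangle-free graph *)

Section Graph.

Variables (V : finType) (adj : rel V).
Hypothesis adjC : symmetric adj.
Hypothesis adj_irr : irreflexive adj.
Hypothesis adj_tri : triangle_free adj.

Implicit Types (A B C S T X : {set V}) (x y z : V).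

Local Open Scope nat_scope.

Definition dg (A : {set V}) (x : V) : nat := \sum_(y in A) adj x y.

(* Ordered pairs: [e2 S S] is twice the number of edges spanned by [S]. *)
Definition e2 (A B : {set V}) : nat := \sum_(x in A) dg B x.

Definition indep (A : {set V}) : bool := [forall x in A, forall y in A, ~~ adj x y].

Definition nbh (x : V) : {set V} := [set y | adj x y].

(** As [e2] counts each edge twice, the bound means at most [n^2/50] edges. The boolean form allows
    reasoning by contraposition. *)
Definition has_half : bool :=
  [exists S : {set V}, (#|S| == #|V| %/ 2) && (25 * e2 S S <= #|V| ^ 2)].

Lemma indepP A : reflect {in A &, forall x y, ~~ adj x y} (indep A).
Proof.
apply: (iffP forall_inP) => h.
  by move=> x y xA yA; move/forall_inP: (h x xA); apply.
by move=> x xA; apply/forall_inP => y yA; apply: h.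
Qed.

Lemma triN x y z : adj x y -> adj x z -> ~~ adj y z.
Proof. by move=> xy xz; apply/negP => yz; case: (adj_tri (And3 xy yz xz)). Qed.

Lemma indep_nbh x : indep (nbh x).
Proof. by apply/indepP => y z; rewrite !inE; apply: triN. Qed.

Lemma indepS (A B : {set V}) : A \subset B -> indep B -> indep A.
Proof.
move=> /subsetP sAB /indepP iB; apply/indepP => x y /sAB xB /sAB yB.
exact: iB.
Qed.

Lemma dgE A x : dg A x = #|A :&: nbh x|.
Proof.
rewrite /dg -sum1_card big_mkcond /= [RHS]big_mkcond /=.
by apply: eq_bigr => y _; rewrite !inE; case: (y \in A); case: (adj x y).
Qed.

Lemma dg_le A x : dg A x <= #|A|.
Proof. by rewrite dgE subset_leq_card ?subsetIl. Qed.

Lemma dgS {A B : {set V}} x : A \subset B -> dg A x <= dg B x.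
Proof. by move=> sAB; rewrite !dgE subset_leq_card ?setSI. Qed.

Lemma dgU A B x : [disjoint A & B] -> dg (A :|: B) x = dg A x + dg B x.
Proof. by move=> dAB; rewrite /dg -bigU //; apply: eq_bigl => y; rewrite !inE. Qed.

Lemma dg_leU A B x : dg (A :|: B) x <= dg A x + dg B x.
Proof. by rewrite !dgE setIUl cardsU leq_subr. Qed.

Lemma dg_indep {A x} : indep A -> x \in A -> dg A x = 0.
Proof.
by move/indepP => iA xA; apply: big1 => y yA; rewrite (negPf (iA x y xA yA)).
Qed.

Lemma dg_tri A x y : adj x y -> dg A x + dg A y <= #|A|.
Proof.
move=> xy; rewrite /dg -big_split /= -sum1_card leq_sum // => z _.
have := @triN x y z xy; case: (adj x z); last by case: (adj y z).
by move=> /(_ isT)/negPf->.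
Qed.

Lemma e2C A B : e2 A B = e2 B A.
Proof.
rewrite /e2 /dg exchange_big /=.
by apply: eq_bigr => y _; apply: eq_bigr => x _; rewrite adjC.
Qed.

Lemma e2Ul A B C : [disjoint A & B] -> e2 (A :|: B) C = e2 A C + e2 B C.
Proof. by move=> dAB; rewrite /e2 -bigU //; apply: eq_bigl => y; rewrite !inE. Qed.

Lemma e2Ur A B C : [disjoint A & B] -> e2 C (A :|: B) = e2 C A + e2 C B.
Proof. by move=> dAB; rewrite e2C e2Ul // e2C [e2 B C]e2C. Qed.

Lemma e2_indep A : indep A -> e2 A A = 0.
Proof. by move=> iA; apply: big1 => x xA; rewrite dg_indep. Qed.

Lemma e2S (A B : {set V}) : A \subset B -> e2 A A <= e2 B B.
Proof.
move=> sAB; rewrite /e2 [X in _ <= X](big_setID A) /= (setIidPr sAB).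
apply: leq_trans (leq_addr _ _); apply: leq_sum => x _; exact: dgS.
Qed.

Lemma subset_of_card (A : {set V}) k :
  k <= #|A| -> exists2 B : {set V}, B \subset A & #|B| = k.
Proof.
move=> kA; exists [set x in take k (enum A)].
  by apply/subsetP => x; rewrite inE => /mem_take; rewrite mem_enum.
rewrite cardsE (card_uniqP _) ?take_uniq ?enum_uniq //.
by rewrite size_takel // -cardE.
Qed.

(** Shrinking a set loses edges, so candidates may be larger than a half. *)
Lemma has_half_sup (T : {set V}) :
  #|V| %/ 2 <= #|T| -> 25 * e2 T T <= #|V| ^ 2 -> has_half.
Proof.
move=> /subset_of_card[S sST cS] eT; apply/existsP; exists S; rewrite cS eqxx /=.
by apply: leq_trans eT; rewrite leq_mul2l e2S.
Qed.

(** Discarding an element of largest [g] never raises the average; repeat until [k] elements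
    remain. *)
Lemma select_min (g : V -> nat) (T : {set V}) k : k <= #|T| ->
  exists X : {set V}, [/\ X \subset T, #|X| = k &
    #|T| * \sum_(x in X) g x <= k * \sum_(x in T) g x].
Proof.
move: {2}(#|T| - k) (erefl (#|T| - k)) => d; elim: d T => [|d IH] T dT kT.
  have <- : #|T| = k by lia.
  by exists T.
have T0 : 0 < #|T| by lia.
case/card_gt0P: (T0) => x0 x0T.
have [m mT mmax] : exists2 m, m \in T & forall x, x \in T -> g x <= g m.
  by case: (arg_maxnP g x0T) => m mT mmax; exists m.
have cT : #|T| = #|T :\ m|.+1 by rewrite (cardsD1 m) mT.
have [||X [sX cX gX]] := IH (T :\ m); [lia|lia|].
exists X; split => //; first exact: subset_trans sX (subD1set _ _).
rewrite [X in _ <= _ * X](big_setD1 m mT) /=.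
have gs : \sum_(x in X) g x <= k * g m.
  rewrite -cX -sum_nat_const; apply: leq_sum => x xX; apply: mmax.
  by move/subsetP: sX => /(_ x xX); rewrite !inE => /andP[].
rewrite cT mulSn mulnDr; exact: leq_add.
Qed.

(** The neighbours [N] in [X] of a vertex of maximum degree are independent, so every edge of [X]
    has an end in the rest [C], whose degrees are at most [#|N|]. *)
Lemma mantel (X : {set V}) : 2 * e2 X X <= #|X| ^ 2.
Proof.
have [->|[x0 x0X]] := set_0Vmem X; first by rewrite /e2 big_set0.
case: (arg_maxnP (dg X) x0X) => m mX mmax.
set N := X :&: nbh m; set C := X :\: nbh m.
have XE : X = N :|: C by rewrite /N /C setID.
have dNC : [disjoint N & C].
  by rewrite -setI_eq0 /N /C; apply/eqP/setP=> y; rewrite !inE; case: adj; rewrite ?andbF.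
have iN : indep N by apply: indepS (indep_nbh m); rewrite subsetIr.
have cX : #|X| = #|N| + #|C| by rewrite -cardsUI -XE (disjoint_setI0 dNC) cards0 addn0.
have e1 : e2 X X <= 2 * e2 C X.
  have -> : e2 X X = e2 N X + e2 C X by rewrite -e2Ul // -XE.
  rewrite mul2n -addnn leq_add2r.
  have -> : e2 N X = e2 C N by rewrite e2C {1}XE e2Ul // (e2_indep iN).
  by apply: leq_sum => x _; apply: dgS; rewrite subsetIl.
have e3 : e2 C X <= #|C| * #|N|.
  rewrite -sum_nat_const; apply: leq_sum => x; rewrite inE => /andP[_ xX].
  by rewrite /N -dgE; apply: mmax.
rewrite cX; apply: leq_trans (nat_AGM2 _ _); rewrite [#|N| * _]mulnC; lia.
Qed.


(** Each edge comes from two distinct ordered pairs [(x, y)] and [(y, x)]. *)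
Lemma spanned_le S : 2 * #|spanned_edges adj S| <= e2 S S.
Proof.
pose P := [set p : V * V | [&& p.1 \in S, p.2 \in S & adj p.1 p.2]].
have <- : #|P| = e2 S S.
  rewrite /e2 /dg pair_big_dep /= -sum1_card big_mkcond /= [RHS]big_mkcond /=.
  by apply: eq_bigr => p _; rewrite inE andbA; do 2 case: (_ \in S) => //=; case: adj.
pose f (p : V * V) : {set V} := [set p.1; p.2].
rewrite -[#|P|]sum1_card (partition_big f (mem (spanned_edges adj S))) /=; last first.
  move=> p; rewrite inE => /and3P[p1 p2 pp]; rewrite inE; apply/andP; split.
    by apply/imset2P; exists p.1 p.2; rewrite ?inE.
  by apply/subsetP => x; rewrite !inE => /orP[]/eqP->.
rewrite mulnC -sum_nat_const; apply: leq_sum => E.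
rewrite inE => /andP[/imset2P[x y _]]; rewrite inE => /andP[_ xy] -> sS.
have xS : x \in S by apply: (subsetP sS); rewrite !inE eqxx.
have yS : y \in S by apply: (subsetP sS); rewrite !inE eqxx orbT.
rewrite (bigD1 (x, y)) /=; last by rewrite /P /f !inE /= xS yS xy eqxx.
rewrite (bigD1 (y, x)) //= /P /f !inE /= xS yS adjC xy /= setUC eqxx /=.
by apply/eqP => -[yx _]; move: xy; rewrite yx adj_irr.
Qed.

(** * The case of an independent set of at least [2n/5] vertices *)

Section LargeIndependentSet.

Variables (R : realFieldType) (I : {set V}).
Hypothesis indI : indep I.
Hypothesis maxI : forall J, indep J -> #|J| <= #|I|.
Hypothesis largeI : 2 * #|V| <= 5 * #|I|.
Hypothesis nohalf : ~~ has_half.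

Let n := #|V|.
Let a := #|I|.
Let k := n %/ 2 - a.
Let S := [set x in ~: I | 2 * dg I x <= a].
Let B := [set x in ~: I | a < 2 * dg I x].

(** Otherwise [I] itself contains a half without edges. *)
Lemma large_indep_lt : 0 < k.
Proof.
rewrite subn_gt0 ltnNge; apply: contra nohalf => h.
by apply: has_half_sup h _; rewrite e2_indep.
Qed.

(** Adjacent vertices have disjoint neighbourhoods in [I], so they cannot both see more than half of
    it. *)
Lemma indep_heavy : indep B.
Proof.
apply/indepP => x y; rewrite !inE => /andP[_ hx] /andP[_ hy]; apply/negP => xy.
by have := dg_tri I xy; rewrite -/a; lia.
Qed.

Lemma dg_split x : dg setT x = dg I x + dg B x + dg S x.
Proof.
rewrite -!dgU.
- congr (dg _ x); apply/setP => y; rewrite !inE (leqNgt (2 * _)).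
  by case: (y \in I) => //=; case: (a < _).
- rewrite -setI_eq0; apply/eqP/setP => y; rewrite !inE (leqNgt (2 * _)).
  by case: (y \in I) => //=; case: (a < _).
- by rewrite -setI_eq0; apply/eqP/setP => y; rewrite !inE; case: (y \in I).
Qed.

Lemma light_card : n <= 2 * a + #|S|.
Proof.
have -> : n = #|I :|: B :|: S|.
  rewrite /n -cardsT; congr #|pred_of_set _|; apply/setP => y.
  rewrite !inE (leqNgt (2 * _)).
  by case: (y \in I) => //=; case: (a < _).
have := maxI indep_heavy; rewrite -/a.
have := cardsU (I :|: B) S; have := cardsU I B; rewrite -/a; lia.
Qed.

Lemma extend_indep X : X \subset S -> #|X| = k ->
  n ^ 2 < 25 * (2 * (\sum_(x in X) dg I x) + e2 X X).
Proof.
move=> XS cX; rewrite ltnNge; apply: contra nohalf => h.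
have dIX : [disjoint I & X].
  rewrite -setI_eq0 -subset0; apply/subsetP => y; rewrite inE => /andP[yI].
  by move/(subsetP XS); rewrite !inE yI.
apply: (has_half_sup (T := I :|: X)).
  have := cardsU I X; rewrite (disjoint_setI0 dIX) cards0 cX.
  by have := large_indep_lt; rewrite /k -/n -/a; lia.
rewrite e2Ul // !e2Ur // e2_indep // (e2C I X) -[e2 X I]/(\sum_(x in X) dg I x).
by apply: leq_trans h; rewrite leq_mul2l /=; lia.
Qed.

(** Among [k] common neighbours of [x] in [S] there is no edge, so adding them to [I] creates at
    most [k * a / 2] edges, few enough for a half. *)
Lemma dg_light x : dg S x < k.
Proof.
rewrite ltnNge; apply/negP; rewrite dgE => /subset_of_card[X sX cX].
have XS : X \subset S by apply: subset_trans sX _; rewrite subsetIl.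
have iX : indep X.
  by apply: indepS (indep_nbh x); apply: subset_trans sX _; rewrite subsetIr.
have := extend_indep XS cX; rewrite (e2_indep iX) addn0.
have : 2 * (\sum_(x in X) dg I x) <= k * a.
  rewrite -cX -sum_nat_const big_distrr /=; apply: leq_sum => y /(subsetP XS).
  by rewrite inE => /andP[].
have : 2 * (k + a) <= n by have := large_indep_lt; rewrite /k; lia.
move: largeI; rewrite -/n -/a => h1 h2 h3 h4.
(* For [a >= 2n/5], [a * (n/2 - a)] is largest at [a = 2n/5], where it equals [n^2/25]. *)
have : 25 * (k * a) <= n ^ 2 by nia.
by lia.
Qed.

Lemma dg_max x : dg setT x <= a.
Proof. by rewrite dgE setTI; exact: maxI (indep_nbh x). Qed.

(** Extend [I] by the [k] vertices of [S] with fewest neighbours in [I], and bound the edges among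
    them by [mantel]. *)
Lemma light_sum :
  #|S| * (2 * n ^ 2) < 100 * (k * \sum_(x in S) dg I x) + #|S| * (25 * k ^ 2).
Proof.
have kS : k <= #|S| by have := light_card; have := large_indep_lt; rewrite /k; lia.
have [X [XS cX gX]] := select_min (dg I) kS.
have h1 := extend_indep XS cX.
have := mantel X; rewrite cX => h2.
have k0 := large_indep_lt.
have h3 : 2 * n ^ 2 < 100 * (\sum_(x in X) dg I x) + 25 * k ^ 2 by lia.
apply: (@leq_trans (100 * (#|S| * \sum_(x in X) dg I x) + #|S| * (25 * k ^ 2))).
  by rewrite (mulnCA 100) -mulnDr ltn_mul2l h3 andbT; lia.
by rewrite leq_add2r leq_mul2l.
Qed.

Local Open Scope ring_scope.

Let D x : R := a%:R - (dg setT x)%:R.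

Lemma deficit_ge0 x : 0 <= D x.
Proof. by rewrite subr_ge0 ler_nat dg_max. Qed.

(* A neighbour [w] of [x] in [B] has [dg I w <= a - dg I x], no neighbour in [B],
   and fewer than [k] neighbours in [S]. *)
Lemma heavy_deficit x : x \in S ->
  (dg B x)%:R * ((dg I x)%:R - (n%:R / 2 - a%:R)) <= \sum_(w in B) D w.
Proof.
move=> xS; rewrite /dg natr_sum mulr_suml; apply: ler_sum => w wB.
case xw: (adj x w); last by rewrite mul0r deficit_ge0.
rewrite mul1r /D dg_split (dg_indep indep_heavy wB) addn0 natrD.
have := dg_tri I xw; rewrite -/a -(ler_nat R) natrD /dg => h1.
have : (dg S w + a <= n %/ 2)%N by have := dg_light w; rewrite /k; lia.
have : (2 * (n %/ 2) <= n)%N by lia.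
rewrite -!(ler_nat R) natrM natrD -/(dg I w) -/(dg I x); move: h1; rewrite /dg; lra.
Qed.

(** Summing [deficit_arith] over [S], with [xi = n/2 - a], bounds the deficits below, while the edge
    count bounds their total above. *)
Lemma large_indep_contra (e : R) : e <= 1 / 1000 ->
  (2 / 5 - e) * n%:R ^+ 2 <= \sum_x (dg setT x)%:R -> False.
Proof.
move=> e1 sumd; have k0 := large_indep_lt.
have kn : (2 * a + 2 * k <= n)%N by rewrite /k; lia.
have kR : 2 * a%:R + 2 * k%:R <= n%:R :> R by rewrite -!natrM -natrD ler_nat.
have aR : 2 * n%:R <= 5 * a%:R :> R by rewrite -!natrM ler_nat.
have k0R : 0 < k%:R :> R by rewrite ltr0n.
have a0R : 0 <= a%:R :> R by rewrite ler0n.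
have n0R : 0 < n%:R :> R by lra.
have xiR : 0 < n%:R / 2 - a%:R :> R by lra.
pose T : R := (\sum_(x in S) dg I x)%:R.
have TE : T = \sum_(x in S) (dg I x)%:R by rewrite /T natr_sum.
apply: (@large_indep_arith R n%:R a%:R k%:R #|S|%:R T
          (\sum_(w in B) D w) (\sum_(x in S) D x) e) => //.
- have := light_card; rewrite -(ler_nat R) natrD natrM; lra.
- rewrite TE mulr_sumr -sum1_card natr_sum mulr_suml; apply: ler_sum => x.
  by rewrite inE => /andP[_]; rewrite -(ler_nat R) natrM mul1r.
- by apply: sumr_ge0 => x _; apply: deficit_ge0.
- have := light_sum; rewrite -(ltr_nat R) natrD (natrM _ #|S| (2 * _)).
  rewrite (natrM _ 2 (n ^ 2)) (natrM _ 100 (k * _)) (natrM _ k) -/T.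
  by rewrite (natrM _ #|S| (25 * _)) (natrM _ 25 (k ^ 2)) !natrX; lra.
- have : \sum_(x in S) (((a%:R/2 - (n%:R/2 - a%:R)) ^+ 2 - a%:R/2 * (a%:R/2))
       + a%:R/2 * (dg I x)%:R - (a%:R/2 - (n%:R/2 - a%:R)) * D x)
     <= \sum_(x in S) \sum_(w in B) D w.
    apply: ler_sum => x xS.
    apply: (@deficit_arith R _ _ _ (dg B x)%:R (dg S x)%:R (dg setT x)%:R).
    + exact: ltW.
    + lra.
    + by move: xS; rewrite inE => /andP[_]; rewrite -(ler_nat R) natrM; lra.
    + have := dg_light x; rewrite -(ltr_nat R); lra.
    + exact: deficit_ge0.
    + by apply: sumr_ge0 => w _; apply: deficit_ge0.
    + by rewrite dg_split !natrD.
    + exact: heavy_deficit.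
  rewrite big_split /= big_split /= sumr_const sumr_const.
  rewrite sumrN -mulr_sumr -TE -mulr_sumr.
  rewrite -[X in X + _ + _ <= _]mulr_natl -[X in _ <= X -> _]mulr_natl.
  lra.
- have : \sum_(x in S) D x + \sum_(w in B) D w <= \sum_x D x.
    rewrite [X in _ <= X](bigID (mem S)) /= lerD2l [X in _ <= X](bigID (mem B)) /=.
    rewrite (eq_bigl (fun w => (w \notin S) && (w \in B))); last first.
      by move=> w; rewrite !inE ltnNge; case: (_ <= _)%N; rewrite ?andbF ?andbT.
    by rewrite lerDl; apply: sumr_ge0 => w _; apply: deficit_ge0.
  rewrite [\sum_x D x]sumrB sumr_const -[a%:R *+ _]mulr_natr -/n; lra.
Qed.

End LargeIndependentSet.

(** * Five-class colourings compared with complete blow-ups of the 5-cycle *)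

Section Pentagon.

Variable (c : V -> 'I_5).

Let n := #|V|.

Definition fiber (i : 'I_5) : {set V} := [set x | c x == i].
Definition bad x y : bool := adj x y && ~~ near (c x) (c y).
Definition miss x y : bool := ~~ adj x y && near (c x) (c y).
Definition badn x : nat := \sum_y bad x y.
Definition missn x : nat := \sum_y miss x y.
Definition gap (i : 'I_5) : nat :=
  \sum_(x in fiber i) \sum_(y in fiber (i + 1)%R) ~~ adj x y.

(** Take a class [l] near both ends: no vertex of it is adjacent to both, so each is missed by [x]
    or by [y]. *)
Lemma bad_miss x y : bad x y -> exists l, #|fiber l| <= missn x + missn y.
Proof.
case/andP=> xy /near_common[l xl yl]; exists l.
rewrite -sum1_card big_mkcond /missn -big_split /=; apply: leq_sum => z _.
rewrite inE; case: eqP => // cz; rewrite /miss cz xl yl !andbT.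
have := triN (y := y) (z := z) (x := x) xy.
case: (adj x z); last by case: (adj y z).
by move/(_ isT)/negPf->.
Qed.

(* Double counting of [sum_x badn x * missn x]: each vertex has few bad edges,
   but the ends of a bad edge miss a whole class, so misses dominate. *)
Lemma sum_bad_miss w b : (forall i, w <= #|fiber i|) -> (forall x, badn x <= b) ->
  w * (\sum_x badn x) <= 2 * b * \sum_x missn x.
Proof.
move=> hw hb.
apply: (@leq_trans (\sum_x \sum_y bad x y * (missn x + missn y))).
  rewrite big_distrr; apply: leq_sum => x _ /=.
  rewrite big_distrr; apply: leq_sum => y _ /=.
  case xy: (bad x y); rewrite ?muln0 // muln1 mul1n.
  by have [l] := bad_miss xy; apply: leq_trans (hw l).
have -> : \sum_x \sum_y bad x y * (missn x + missn y) = 2 * \sum_x badn x * missn x.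
  under eq_bigr do (under eq_bigr do rewrite mulnDr; rewrite big_split /=).
  rewrite big_split /= [X in _ + X]exchange_big /= mul2n -addnn.
  congr (_ + _); apply: eq_bigr => x _; rewrite /badn big_distrl //=.
  by apply: eq_bigr => y _; rewrite /bad adjC nearC.
rewrite -mulnA leq_mul2l /= big_distrr; apply: leq_sum => x _.
by rewrite leq_mul2r hb orbT.
Qed.

Lemma sum_missn : \sum_x missn x = 2 * \sum_i gap i.
Proof.
have E (F : 'I_5 -> 'I_5) : \sum_x \sum_y (~~ adj x y && (c y == F (c x))) =
    \sum_i \sum_(x in fiber i) \sum_(y in fiber (F i)) ~~ adj x y.
  rewrite (partition_big c predT) //=; apply: eq_bigr => i _.
  apply: eq_big => [x|x /eqP->]; first by rewrite inE.
  rewrite [RHS]big_mkcond; apply: eq_bigr => y _; rewrite inE.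
  by case: (_ == _); rewrite ?andbT ?andbF.
have -> : \sum_x missn x = \sum_x \sum_y (~~ adj x y && (c y == (c x + 1)%R))
     + \sum_x \sum_y (~~ adj x y && (c y == (c x - 1)%R)).
  rewrite -big_split; apply: eq_bigr => x _ /=.
  rewrite -big_split; apply: eq_bigr => y _ /=.
  rewrite /miss /near; case: adj => //=.
  by move: (c x) (c y) => i j; ord5 i; ord5 j.
(* Exchanging [x] and [y] matches the pairs going back one class with those going forward. *)
rewrite [X in _ + X](_ : _ = \sum_x \sum_y (~~ adj x y && (c y == (c x + 1)%R))).
  by rewrite addnn -mul2n (E (fun i => (i + 1)%R)).
rewrite exchange_big; apply: eq_bigr => y _; apply: eq_bigr => x _ /=.
by rewrite adjC eq_sym subr_eq.
Qed.

(** The half consists of classes [i], [i + 2] and the [k] vertices of class [i + 3] with fewest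
    neighbours in class [i + 2]; [G] counts the edges between the last two pieces. *)
Lemma pentagon_candidate i : ~~ has_half ->
  let k := n %/ 2 - (#|fiber i| + #|fiber (i + 2)%R|) in
  k <= #|fiber (i + 3)%R| -> exists G,
  [/\ n ^ 2 < 25 * (\sum_x badn x + 2 * G),
      gap (i + 2)%R <= #|fiber (i + 2)%R| * #|fiber (i + 3)%R| &
      #|fiber (i + 3)%R| * G + k * gap (i + 2)%R
        <= k * (#|fiber (i + 2)%R| * #|fiber (i + 3)%R|)].
Proof.
move=> nohalf k kle; set F := fiber (i + 2)%R.
have [X [XS cX gX]] := select_min (dg F) kle.
have split_edges : \sum_(x in fiber (i + 3)%R) dg F x + gap (i + 2)%R
    = #|F| * #|fiber (i + 3)%R|.
  rewrite -/(e2 (fiber (i + 3)%R) F) e2C /gap.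
  have -> : (i + 2 + 1)%R = (i + 3)%R :> 'I_5.
    by rewrite -addrA; congr (i + _)%R; apply: val_inj.
  rewrite -big_split -sum_nat_const; apply: eq_bigr => x _ /=.
  rewrite -big_split -sum1_card; apply: eq_bigr => y _ /=.
  by case: adj.
exists (\sum_(x in X) dg F x); split; last 2 first.
- by rewrite -split_edges leq_addl.
- by rewrite -split_edges mulnDr leq_add2r.
rewrite ltnNge; apply: contra nohalf => h.
set T := fiber i :|: F :|: X.
have XT x : x \in X -> c x = (i + 3)%R by move/(subsetP XS); rewrite inE => /eqP.
have dij : [disjoint fiber i & F].
  rewrite -setI_eq0; apply/eqP/setP => x; rewrite !inE.
  by move: (c x) => p; clear; ord5 i; ord5 p.
have diX : [disjoint fiber i :|: F & X].
  rewrite -setI_eq0 -subset0; apply/subsetP => x; rewrite !inE => /andP[hx /XT cx].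
  by move: hx; rewrite cx; clear; ord5 i.
apply: (has_half_sup (T := T)).
  have := cardsU (fiber i :|: F) X; have := cardsU (fiber i) F.
  rewrite (disjoint_setI0 dij) (disjoint_setI0 diX) cards0 cX -/T /k -/F -/n; lia.
apply: leq_trans h; rewrite leq_mul2l /= mul2n -addnn.
have e2E A B : e2 A B = \sum_x \sum_y [&& x \in A, y \in B & adj x y].
  rewrite /e2 big_mkcond; apply: eq_bigr => x _; rewrite /dg.
  case: (x \in A); last by rewrite big1.
  by rewrite big_mkcond; apply: eq_bigr => y _; case: (y \in B).
(* Compare pair by pair: an adjacent pair inside [T] is bad or joins [X] and [F]. *)
rewrite -/(e2 X F) {2}e2C !e2E addnA -!big_split; apply: leq_sum => x _ /=.
rewrite -!big_split; apply: leq_sum => y _ /=.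
case xy: (adj x y); last by rewrite !andbF.
rewrite /bad xy /= !andbT; case nxy: (near _ _); last first.
  by apply: leq_trans (leq_b1 _) (leq_addr _ _).
rewrite !inE.
case xX: (x \in X); case yX: (y \in X); rewrite ?orbT ?orbF ?andbT ?andbF //=.
- by move: nxy; rewrite (XT _ xX) (XT _ yX); clear; ord5 i.
- by move: nxy; rewrite (XT _ xX); move: (c y) => q; clear; ord5 i; ord5 q.
- by move: nxy; rewrite (XT _ yX); move: (c x) => q; clear; ord5 i; ord5 q.
- by move: nxy; move: (c x) (c y) => p q; clear; ord5 i; ord5 p; ord5 q.
Qed.

Lemma card_fiber : \sum_i #|fiber i| = n.
Proof.
rewrite /n -sum1_card (partition_big c predT) //=; apply: eq_bigr => i _.
by rewrite -sum1_card; apply: eq_bigl => x; rewrite inE.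
Qed.

Lemma pentagon_half (R : realFieldType) :
  (forall i, 19 / 100 * n%:R <= #|fiber i|%:R :> R /\
             #|fiber i|%:R <= 21 / 100 * n%:R :> R)%R ->
  (forall x, (badn x)%:R <= 3 / 500 * n%:R :> R)%R -> has_half.
Proof.
move=> hfR hbR; apply: contraT => nohalf.
have hf i : 19 * n <= 100 * #|fiber i| /\ 100 * #|fiber i| <= 21 * n.
  by have [] := hfR i; split; rewrite -(ler_nat R) !natrM; lra.
have hb x : 500 * badn x <= 3 * n.
  by have := hbR x; rewrite -(ler_nat R) (natrM _ 500) (natrM _ 3); lra.
have n0 : 0 < n.
  rewrite lt0n; apply: contra nohalf => /eqP n0.
  by apply: (has_half_sup (T := set0)); rewrite -/n ?n0 // /e2 big_set0.
have n0R : (0 < n%:R :> R)%R by rewrite ltr0n.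
pose w i : R := (#|fiber i|%:R)%R.
have wl i : (19 * n%:R <= 100 * w i)%R by have [+ _] := hf i; rewrite -(ler_nat R) !natrM.
have wu i : (100 * w i <= 21 * n%:R)%R by have [_ +] := hf i; rewrite -(ler_nat R) !natrM.
have sw : (\sum_i w i = n%:R)%R by rewrite -card_fiber natr_sum.
pose b2 : R := ((\sum_x badn x)%:R)%R; pose m2 : R := ((\sum_x missn x)%:R)%R.
have m2E : (\sum_i (gap i)%:R = m2 / 2)%R.
  by rewrite /m2 sum_missn natrM natr_sum mulrC mulKf ?pnatr_eq0.
have b2m2 : (95 * b2 <= 6 * m2)%R.
  (* Rounding [19n/100] up and [3n/500] down keeps the natural-number bounds as strong as the real
     ones. *)
  have hw i : (19 * n + 99) %/ 100 <= #|fiber i| by have := hf i; lia.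
  have hB x : badn x <= 3 * n %/ 500 by have := hb x; lia.
  have := sum_bad_miss hw hB.
  rewrite -(ler_nat R) natrM (natrM _ (2 * _)) (natrM _ 2) -/b2 -/m2 => h.
    have h1 : (19 * n%:R <= 100 * ((19 * n + 99) %/ 100)%:R :> R)%R.
      by rewrite -!natrM ler_nat; lia.
    have h2 : (500 * (3 * n %/ 500)%:R <= 3 * n%:R :> R)%R.
      by rewrite -!natrM ler_nat; lia.
    have b0 : (0 <= b2)%R by rewrite ler0n.
    have m0 : (0 <= m2)%R by rewrite ler0n.
    rewrite -(ler_pM2l n0R); nra.
(* The [+ 1] records a strict inequality between natural numbers. *)
have key i : (n%:R ^+ 2 + 1 <=
    25 * (b2 + 2 * ((n%:R / 2 - w i - w (i + 2)) * w (i + 2)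
                    - 38/100 * (gap (i + 2)%R)%:R)))%R.
  have kle : n %/ 2 - (#|fiber i| + #|fiber (i + 2)%R|) <= #|fiber (i + 3)%R|.
    by have := hf i; have := hf (i + 2)%R; have := hf (i + 3)%R; lia.
  have kfl : 2 * (n %/ 2 - (#|fiber i| + #|fiber (i + 2)%R|))
      + 2 * (#|fiber i| + #|fiber (i + 2)%R|) <= n.
    have [_ u0] := hf i; have [_ u2] := hf (i + 2)%R; clear -u0 u2.
    by move: #|_| #|_| u0 u2 => p q; lia.
  have [G [hG gle hsum]] := pentagon_candidate nohalf kle.
  have hGR : (n%:R ^+ 2 + 1 <= 25 * (b2 + 2 * G%:R))%R.
    move: hG; rewrite -(ler_nat R) -addn1 natrD natrX (natrM _ 25) natrD (natrM _ 2).
    by [].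
  apply: (le_trans hGR); rewrite ler_pM2l // lerD2l ler_pM2l //.
  have := wl i; have := wu i; have := wl (i + 2)%R; have := wu (i + 2)%R.
  have := wl (i + 3)%R; have := wu (i + 3)%R => u3 l3 u2 l2 u0 l0.
  have kxi : ((n %/ 2 - (#|fiber i| + #|fiber (i + 2)%R|))%:R
      <= n%:R / 2 - w i - w (i + 2))%R.
    move: kfl; rewrite -(ler_nat R) natrD (natrM _ 2) (natrM _ 2 (_ + _)).
    by rewrite (natrD _ #|fiber i|) -/(w _) -/(w _); lra.
  apply: (@candidate_arith R n%:R _ (w (i + 3)%R) _ _ _ _ n0R (ler0n _ _) kxi)
    => //; try lra.
  - by rewrite -natrM ler_nat.
  - by rewrite -!natrM -natrD ler_nat.
(* Summing [key] and applying [pentagon_weights] gives [5 <= 125 * b2 - 19/2 * m2], which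
   contradicts [b2 <= 6/95 * m2]. *)
have : (\sum_(i < 5) (n%:R ^+ 2 + 1) <=
    \sum_(i < 5) 25 * (b2 + 2 * ((n%:R / 2 - w i - w (i + 2)) * w (i + 2)
                                - 38/100 * (gap (i + 2)%R)%:R)) :> R)%R.
  by apply: ler_sum => i _.
rewrite sumr_const -mulr_sumr big_split /= sumr_const -mulr_sumr sumrB -mulr_sumr.
rewrite (sum_shift5 (fun i => (gap i)%:R)%R) m2E card_ord.
have := pentagon_weights sw => hw h.
have m0 : (0 <= m2)%R by rewrite ler0n.
rewrite -(mulr_natl _ 5) -(mulr_natl b2 5) in h.
lra.
Qed.

End Pentagon.

Lemma card_sum_mem A : #|A| = \sum_x (x \in A).
Proof.
by rewrite -sum1_card big_mkcond; apply: eq_bigr => x _; case: (_ \in _).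
Qed.

(** * The blow-up structure around a given 5-cycle *)

Section Blowup.

Variable v : 'I_5 -> V.
Hypothesis v_adj : forall i, adj (v i) (v (i + 1)%R).

Definition part (i : 'I_5) : {set V} :=
  [set x | adj x (v (i - 1)%R) && adj x (v (i + 1)%R)].
Definition leftover : {set V} := [set x | [forall i, x \notin part i]].

Lemma v_near i j : near i j -> adj (v i) (v j).
Proof.
case/orP=> /eqP->; first exact: v_adj.
by have := v_adj (i - 1)%R; rewrite subrK adjC.
Qed.

Lemma part_near x i j : x \in part i -> near i j -> adj x (v j).
Proof. by rewrite inE => /andP[x1 x2] /orP[]/eqP->. Qed.

(** If [i] and [j] differ, some cycle neighbours of [i] and of [j] are adjacent to each other, and
    [x] would form a triangle with them. *)
Lemma part_inj x i j : x \in part i -> x \in part j -> i = j.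
Proof.
move=> xi xj; apply/eqP; apply: contraT => ij.
have [[k l] /= /and3P[ik jl kl]] : exists p : 'I_5 * 'I_5,
    [&& near i p.1, near j p.2 & near p.1 p.2].
  suff : [|| near (i - 1) (j - 1), near (i - 1) (j + 1),
             near (i + 1) (j - 1) | near (i + 1) (j + 1)]%R.
    have n1 k : near k (k + 1)%R by rewrite /near eqxx.
    have n2 k : near k (k - 1)%R by rewrite /near eqxx orbT.
    case/or4P=> hn.
    - by exists (i - 1, j - 1)%R; rewrite /= !n2.
    - by exists (i - 1, j + 1)%R; rewrite /= n1 n2.
    - by exists (i + 1, j - 1)%R; rewrite /= n1 n2.
    - by exists (i + 1, j + 1)%R; rewrite /= !n1.
  by move: ij; clear; ord5 i; ord5 j.
have := triN (part_near xi ik) (part_near xj jl).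
by rewrite v_near.
Qed.

Lemma part_adj x y i j : x \in part i -> y \in part j -> adj x y -> near i j.
Proof.
move=> xi yj xy; apply: contraT => /near_common[l il jl].
by have := triN xy (part_near xi il); rewrite (part_near yj jl).
Qed.

Lemma dg_part x i j : x \in part i -> ~~ near i j -> dg (part j) x = 0.
Proof.
move=> xi nij; apply: big1 => y yj; case xy: (adj x y) => //.
by rewrite (part_adj xi yj xy) in nij.
Qed.

Lemma part_disjoint i j : i != j -> [disjoint part i & part j].
Proof.
move=> ij; rewrite -setI_eq0 -subset0; apply/subsetP => x; rewrite inE.
by case/andP=> xi xj; rewrite (part_inj xi xj) eqxx in ij.
Qed.

Lemma card_part2 i : #|part i| + #|part (i + 2)%R| <= #|nbh (v (i + 1)%R)|.
Proof.
rewrite -cardsUI (disjoint_setI0 (part_disjoint _)) ?cards0 ?addn0; last first.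
  by ord5 i.
apply: subset_leq_card; apply/subsetP => x; rewrite !inE [adj (v _) x]adjC.
case/orP=> /andP[//]; rewrite (_ : i + 2 - 1 = i + 1)%R //.
by rewrite -addrA; congr (i + _)%R; apply: val_inj.
Qed.

(** The neighbours of [x] on the cycle are pairwise nonconsecutive, so there are at most two; two of
    them would put [x] in a part. *)
Lemma cycle_hits x : \sum_i adj x (v i) + (x \in leftover) <= 2.
Proof.
have nadj i j : near i j -> ~~ (adj x (v i) && adj x (v j)).
  by move=> ij; apply/negP=> /andP[a b]; have := triN a b; rewrite v_near.
have := nadj 0%R 1%R isT; have := nadj 1%R 2%R isT; have := nadj 2%R 3%R isT.
have := nadj 3%R 4%R isT; have := nadj 4%R 0%R isT.
rewrite (sum5 (fun i => adj x (v i) : nat)).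
have [xl|_] := boolP (x \in leftover); last first.
  clear; case: (adj x (v 0%R)); case: (adj x (v 1%R)); case: (adj x (v 2%R));
    by case: (adj x (v 3%R)); case: (adj x (v 4%R)).
have npart i j k : (i - 1 == j)%R -> (i + 1 == k)%R -> ~~ (adj x (v j) && adj x (v k)).
  by move=> /eqP<- /eqP<-; move: xl; rewrite inE => /forallP/(_ i); rewrite inE.
have := npart 0%R 4%R 1%R isT isT.
have := npart 1%R 0%R 2%R isT isT.
have := npart 2%R 1%R 3%R isT isT.
have := npart 3%R 2%R 4%R isT isT.
have := npart 4%R 3%R 0%R isT isT.
clear; case: (adj x (v 0%R)); case: (adj x (v 1%R)); case: (adj x (v 2%R));
  by case: (adj x (v 3%R)); case: (adj x (v 4%R)).
Qed.

(** Consequently, five cycle degrees close to [2n/5] leave few vertices outside the parts. *)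
Lemma sum_cycle_degrees : \sum_i dg setT (v i) + #|leftover| <= 2 * #|V|.
Proof.
have -> : \sum_i dg setT (v i) = \sum_x \sum_i adj x (v i).
  rewrite [RHS]exchange_big; apply: eq_bigr => i _; rewrite /dg.
  by apply: eq_big => [x|x _]; rewrite ?inE // adjC.
rewrite card_sum_mem -big_split /=.
apply: (@leq_trans (\sum_(x : V) 2)); last by rewrite sum_nat_const mulnC.
by apply: leq_sum => x _; apply: cycle_hits.
Qed.

Lemma cover_part : #|V| <= #|leftover| + \sum_i #|part i|.
Proof.
under [X in _ <= _ + X]eq_bigr do rewrite card_sum_mem.
rewrite [X in _ <= _ + X]exchange_big card_sum_mem -big_split -sum1_card /=.
apply: leq_sum => x _; case: (boolP (x \in leftover)) => //.
by rewrite inE negb_forall => /existsP[i]; rewrite negbK => xi; rewrite (bigD1 i) //= xi.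
Qed.

Lemma dg_outside y j : dg (~: (part (j - 1)%R :|: part (j + 1)%R)) y <=
  #|leftover| + dg (part j) y + dg (part (j + 2)%R) y + dg (part (j - 2)%R) y.
Proof.
set C := part j; set C2 := part (j + 2)%R; set C3 := part (j - 2)%R.
apply: (@leq_trans (dg (leftover :|: C :|: C2 :|: C3) y)).
  apply: dgS; apply/subsetP => x; rewrite in_setC in_setU negb_or => /andP[x1 x2].
  rewrite !in_setU; apply: contraT; rewrite !negb_or -!andbA => /and4P[xl x3 x4 x5].
  move: xl; rewrite inE negb_forall => /existsP[i]; rewrite negbK => xi.
  suff : i \in [:: j - 1; j + 1; j; j + 2; j - 2]%R.
    rewrite !inE => /or4P[/eqP ie|/eqP ie|/eqP ie|/orP[]/eqP ie];
      move: xi; rewrite ie => xi.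
    - by rewrite xi in x1.
    - by rewrite xi in x2.
    - by rewrite /C xi in x3.
    - by rewrite /C2 xi in x4.
    - by rewrite /C3 xi in x5.
  by clear; ord5 i; ord5 j.
apply: leq_trans (dg_leU _ _ _) _; rewrite leq_add2r.
apply: leq_trans (dg_leU _ _ _) _; rewrite leq_add2r.
by apply: leq_trans (dg_leU _ _ _) _; rewrite leq_add2r dg_le.
Qed.

End Blowup.

(** * The case where all independent sets have at most [2n/5] vertices *)

Section NearPentagon.

Variable R : realFieldType.

Let n := #|V|.

Hypothesis n0 : 0 < n.
Hypothesis small_indep : forall J, indep J -> (#|J|%:R <= 2 / 5 * n%:R :> R)%R.

Definition high_degree (h : R) : {set V} :=
  [set x | (2 / 5 * n%:R - h <= (dg setT x)%:R)%R].

Lemma dg_gt0P A x : 0 < dg A x -> exists2 y, y \in A & adj x y.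
Proof.
by rewrite dgE => /card_gt0P[y]; rewrite !inE => /andP[]; exists y.
Qed.

Lemma dg_setID h A x (D := high_degree h) : (#|~: D|%:R <= h)%R ->
  ((dg A x)%:R <= (dg (A :&: D) x)%:R + h :> R)%R.
Proof.
move=> cardD; have : dg A x <= dg (A :&: D) x + #|~: D|.
  rewrite -[A in dg A x](setID A D); apply: leq_trans (dg_leU _ _ _) _.
  rewrite leq_add2l; apply: leq_trans (dg_le _ _) _.
  by rewrite subset_leq_card // setDE subsetIr.
by rewrite -(ler_nat R) natrD => /le_trans; apply; rewrite lerD2l.
Qed.

(** Split [D] into the neighbours [I] of [u], the vertices [Y] with a neighbour in [I], and the rest
    [Z]. Without a 5-cycle, [Y] and [I :|: Z] are both independent, so [D] has at most [4n/5]
    vertices, too few. *)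
Lemma exists_pentagon h (D := high_degree h) :
  (0 <= h)%R -> (4000 * h <= n%:R)%R -> (#|~: D|%:R <= h)%R -> exists v : 'I_5 -> V,
  (forall i, v i \in D) /\ (forall i, adj (v i) (v (i + 1)%R)).
Proof.
move=> h0 h1 cardD; have cD : (n%:R - h <= #|D|%:R :> R)%R.
  have := cardsC D; rewrite -/n => /(congr1 (fun k => k%:R : R)).
  by rewrite natrD => E; move: cardD; lra.
have n0R : (0 < n%:R :> R)%R by rewrite ltr0n.
have /card_gt0P[u uD] : 0 < #|D| by rewrite -(ltr0n R); lra.
have dgD x : x \in D -> (2 / 5 * n%:R - 2 * h <= (dg D x)%:R)%R.
  by move=> xD; have := dg_setID setT x cardD; rewrite setTI; move: xD; rewrite inE; lra.
pose I := D :&: nbh u; pose Q := D :\: I.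
pose Z := [set x in Q | dg I x == 0]; pose Y := [set x in Q | 0 < dg I x].
have iI : indep I by apply: indepS (indep_nbh u); rewrite subsetIr.
(* An edge inside [Y] closes a 5-cycle through [u]. *)
have [iY|] := boolP (indep Y); last first.
  rewrite /indep negb_forall_in => /exists_inP[x xY].
  rewrite negb_forall_in => /exists_inP[w wY]; rewrite negbK => xw.
  move: xY wY; rewrite !inE => /andP[/andP[_ xD] /dg_gt0P[a aI xa]].
  move=> /andP[/andP[_ wD] /dg_gt0P[b bI wb]].
  move: aI bI; rewrite !inE => /andP[aD ua] /andP[bD ub].
  exists (fun i : 'I_5 => nth u [:: u; a; x; w; b] i); split.
    by move: uD; rewrite inE => uD i; ord5 i; rewrite /= inE.
  have ax : adj a x by rewrite adjC.
  have bu : adj b u by rewrite adjC.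
  by move=> i; ord5 i; [exact: ua | exact: ax | exact: xw | exact: wb | exact: bu].
have cDE : #|D| = #|I| + #|Q|.
  by rewrite -(cardsID I D) (setIidPr (subsetIl _ _)).
have cQE : #|Q| = #|Z| + #|Y|.
  rewrite -cardsUI (_ : Z :&: Y = set0) ?cards0 ?addn0; last first.
    by apply/setP => x; rewrite !inE lt0n; case: eqP; rewrite ?andbF.
  congr #|pred_of_set _|; apply/setP => x; rewrite !inE lt0n.
  by case: eqP; rewrite ?andbF ?andbT ?orbF.
have dIQ x : (dg D x <= dg I x + dg Q x)%N.
  by rewrite -[D in dg D x](setID D I) (setIidPr (subsetIl _ _)) dg_leU.
(* Adjacent vertices of [Z] would have disjoint neighbourhoods in [Q], each of about [2n/5]
   vertices, while [Q] has only about [3n/5]. *)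
have iZ : indep Z.
  apply/indepP => z z'; rewrite !inE.
  move=> /andP[/andP[_ zD] /eqP z0] /andP[/andP[_ zD'] /eqP z0'].
  apply/negP => zz; have := dg_tri Q zz; have := dIQ z; have := dIQ z'.
  have := dgD z; have := dgD z'; have := dgD u uD; rewrite {1}dgE -/I !inE z0 z0' !add0n.
  move=> d1 /(_ zD') d2 /(_ zD) d3.
  have := congr1 (fun k => k%:R : R) cDE; rewrite natrD.
  have := max_card D; rewrite -/n.
  rewrite -!(ler_nat R) natrD; lra.
have iIZ : indep (I :|: Z).
  have nIZ x z : x \in I -> z \in Z -> ~~ adj x z.
    move=> xI; rewrite inE => /andP[_]; apply: contraL; rewrite adjC => zx.
    by rewrite -lt0n dgE; apply/card_gt0P; exists x; rewrite inE xI inE.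
  apply/indepP => x y /setUP[xI|xZ] /setUP[yI|yZ].
  - exact: (indepP _ iI).
  - exact: nIZ.
  - by rewrite adjC; apply: nIZ.
  - exact: (indepP _ iZ).
have := small_indep iIZ; have := small_indep iY.
have -> : #|I :|: Z| = #|I| + #|Z|.
  rewrite -cardsUI (_ : I :&: Z = set0) ?cards0 ?addn0 //.
  by apply/setP => x; rewrite !inE; case: (_ <= _)%R; case: (adj u x).
have := congr1 (fun k => k%:R : R) cDE; rewrite cQE !natrD; lra.
Qed.

Lemma near_pentagon_half h (D := high_degree h) :
  (0 <= h)%R -> (4000 * h <= n%:R)%R -> (#|~: D|%:R <= h)%R -> has_half.
Proof.
move=> h0 h1 cardD; have [v [vD v_adj]] := exists_pentagon h0 h1 cardD.
have n0R : (0 < n%:R :> R)%R by rewrite ltr0n.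
pose U := part v; pose L := leftover v.
have cnbh x : (#|nbh x|%:R <= 2 / 5 * n%:R :> R)%R := small_indep (indep_nbh x).
have cL : (#|L|%:R <= 5 * h)%R.
  have := sum_cycle_degrees v_adj; rewrite -/L -/n -(ler_nat R) natrD natr_sum natrM.
  have : (\sum_(i < 5) (2 / 5 * n%:R - h) <= \sum_i (dg setT (v i))%:R)%R.
    by apply: ler_sum => i _; have := vD i; rewrite inE.
  by rewrite sumr_const card_ord -(mulr_natl _ 5); lra.
have addn12 i : (i + 1 + 2 = i + 3 :> 'I_5)%R.
  by rewrite -addrA; congr (i + _)%R; apply: val_inj.
have addn22 i : (i + 2 + 2 = i + 4 :> 'I_5)%R.
  by rewrite -addrA; congr (i + _)%R; apply: val_inj.
have subn12 i : (i - 1 + 2 = i + 1 :> 'I_5)%R.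
  by rewrite -addrA; congr (i + _)%R; apply: val_inj.
have U2 i : (#|U i|%:R + #|U (i + 2)%R|%:R <= 2 / 5 * n%:R :> R)%R.
  by apply: le_trans (cnbh (v (i + 1)%R)); rewrite -natrD ler_nat; apply: card_part2.
(* The four other parts form two pairs at distance two, each pair of size at most [2n/5] by [U2]. *)
have Ulow i : (n%:R / 5 - 5 * h <= #|U i|%:R)%R.
  have := cover_part v; rewrite -/L -/n -(ler_nat R) natrD natr_sum (sum5_from _ i).
  have := U2 (i + 1)%R; have := U2 (i + 2)%R; rewrite addn12 addn22; lra.
have Uup i : (#|U i|%:R <= n%:R / 5 + 5 * h)%R.
  by have := U2 i; have := Ulow (i + 2)%R; lra.
(* Such an [x] misses at most [6h] vertices of its two neighbouring parts, and [y] shares no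
   neighbour with [x]. *)
have dgU_small x y i j : x \in U i -> x \in D -> near i j -> adj x y ->
    ((dg (U j) y)%:R <= 6 * h)%R.
  move=> xi xD ij xy.
  have dx : (2 / 5 * n%:R - h <=
      (dg (U (i - 1)%R) x)%:R + (dg (U (i + 1)%R) x)%:R + #|L|%:R)%R.
    move: xD; rewrite inE => /le_trans; apply; rewrite -!natrD ler_nat.
    rewrite -(setUCr (U (i - 1)%R :|: U (i + 1)%R)).
    apply: leq_trans (dg_leU _ _ _) _; apply: leq_add; first exact: dg_leU.
    apply: leq_trans (dg_outside _ _ _) _.
    by rewrite !(dg_part xi) ?addn0 //; move: (i); clear => i; ord5 i.
  have := U2 (i - 1)%R; rewrite subn12.
  have le1 := dg_le (U (i - 1)%R) x; have le2 := dg_le (U (i + 1)%R) x.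
  have := dg_tri (U j) xy; move: le1 le2; rewrite -!(ler_nat R) natrD.
  by case/orP: ij => /eqP->; lra.
(* The class [j] of [y] is chosen so that few neighbours of [y] lie outside parts [j - 1] and
   [j + 1]: at most [5h] in [L] and [18h] in the three other parts. *)
have class y : exists j, (forall i, y \in U i -> j = i) /\
    ((dg (~: (U (j - 1)%R :|: U (j + 1)%R)) y)%:R <= 23 * h)%R.
  have [/existsP[i yi]|] := boolP [exists i, y \in U i].
    exists i; split=> [i' yi'|]; first exact: part_inj yi yi'.
    have : dg (~: (U (i - 1)%R :|: U (i + 1)%R)) y <= #|L|.
      apply: leq_trans (dg_outside _ _ _) _.
      by rewrite !(dg_part yi) ?addn0 //; move: (i); clear => i; ord5 i.
    by rewrite -(ler_nat R); lra.
  rewrite negb_exists => /forallP yU.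
  suff [j hj] : exists j,
      ((dg (U j) y)%:R + (dg (U (j + 2)%R) y)%:R + (dg (U (j - 2)%R) y)%:R <= 18 * h)%R.
    exists j; split=> [i yi|]; first by have := yU i; rewrite yi.
    by have := dg_outside v y j; rewrite -(ler_nat R) !natrD -/L -!/(U _); lra.
  have far j : ~~ (0 < dg (U j :&: D) y) -> ((dg (U j) y)%:R <= h)%R.
    by rewrite -eqn0Ngt => /eqP E; have := dg_setID (U j) y cardD; rewrite -/D E add0r.
  have [/existsP[i]|] := boolP [exists i, 0 < dg (U i :&: D) y]; last first.
    rewrite negb_exists => /forallP yD; exists 0%R.
    have := far _ (yD 0%R); have := far _ (yD (0 + 2)%R).
    by have := far _ (yD (0 - 2)%R); lra.
  case/dg_gt0P => x; rewrite inE adjC => /andP[xi xD] xy.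
  have d1 : ((dg (U (i + 1)%R) y)%:R <= 6 * h)%R.
    by apply: dgU_small xi xD _ xy; rewrite /near eqxx.
  have d2 : ((dg (U (i - 1)%R) y)%:R <= 6 * h)%R.
    by apply: dgU_small xi xD _ xy; rewrite /near eqxx orbT.
  (* A second high-degree neighbour in part [i + 2] makes [i + 1] the right class; otherwise part
     [i + 2] holds few neighbours of [y], and [i - 1] works. *)
  have [/dg_gt0P[x']|] := boolP (0 < dg (U (i + 2)%R :&: D) y).
    rewrite inE adjC => /andP[xi' xD'] xy'.
    exists (i + 1)%R; rewrite addn12.
    have -> : (i + 1 - 2 = i - 1)%R by rewrite -addrA; congr (i + _)%R; apply: val_inj.
    have : ((dg (U (i + 3)%R) y)%:R <= 6 * h)%R.
      by apply: dgU_small xi' xD' _ xy'; move: (i); clear => i; ord5 i.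
    lra.
  move/far => d3; exists (i - 1)%R; rewrite subn12.
  have -> : (i - 1 - 2 = i + 2)%R by rewrite -addrA; congr (i + _)%R; apply: val_inj.
  lra.
have [c cP] := fin_all_exists class.
have cU x i : x \in U i -> c x = i by move=> xi; have [+ _] := cP x; apply.
apply: (@pentagon_half c R) => [i|x].
  have sU : U i \subset fiber c i by apply/subsetP => x xi; rewrite inE (cU _ _ xi).
  have sL : fiber c i \subset U i :|: L.
    apply/subsetP => x; rewrite !inE => /eqP cx; apply: contraT.
    rewrite negb_or => /andP[xi]; rewrite negb_forall => /existsP[j].
    rewrite negbK => xj; move: xi; rewrite -cx (cU _ _ xj) => /negP[].
    by move: xj; rewrite inE.
  have := subset_leq_card sU.
  have := leq_trans (subset_leq_card sL) (leq_card_setU _ _).1.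
  rewrite -!(ler_nat R) natrD; have := Ulow i; have := Uup i; split; lra.
have : badn c x <= dg (~: (U (c x - 1)%R :|: U (c x + 1)%R)) x.
  rewrite /dg [X in _ <= X]big_mkcond; apply: leq_sum => y _.
  rewrite /bad in_setC in_setU; case: (adj x y) => //=.
  case: ifP => [_|/negbT]; first exact: leq_b1.
  by rewrite negbK /near => /orP[]/cU->; rewrite eqxx ?orbT.
(* The choice of [4000] is used here: [23/4000 < 3/500]. *)
by have [_ +] := cP x; rewrite -(ler_nat R); lra.
Qed.

End NearPentagon.

(** * Combining the two cases *)

Lemma dense_half (R : realFieldType) :
  ((2 / 5 - (1 / 4000) ^+ 2) * #|V|%:R ^+ 2 <= \sum_x (dg setT x)%:R :> R)%R ->
  has_half.
Proof.
move=> dense; set n := #|V| in dense *.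
have [n0|n0] := posnP n.
  by apply: (has_half_sup (T := set0)); rewrite -/n ?n0 // /e2 big_set0.
have n0R : (0 < n%:R :> R)%R by rewrite ltr0n.
have ind0 : indep set0 by apply/indepP => x y; rewrite inE.
case: (arg_maxnP (fun J : {set V} => #|J|) ind0) => I indI maxI.
have [large|small] := leqP (2 * n) (5 * #|I|).
  apply: contraT => nohalf.
  have dense' : ((2 / 5 - 1 / 1000) * n%:R ^+ 2 <= \sum_x (dg setT x)%:R :> R)%R.
    apply: le_trans dense; rewrite ler_pM2r ?exprn_gt0 //; lra.
  by case: (large_indep_contra indI maxI large nohalf _ dense').
have small_indep J : indep J -> (#|J|%:R <= 2 / 5 * n%:R :> R)%R.
  move/maxI => JI; have : 5 * #|J| <= 2 * n by move: JI => /=; lia.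
  by rewrite -(ler_nat R) !natrM; lra.
pose h : R := (n%:R / 4000)%R.
have h0 : (0 < h)%R by rewrite divr_gt0.
have hE : (4000 * h = n%:R)%R by rewrite /h mulrC divfK // pnatr_eq0.
apply: (@near_pentagon_half R n0 small_indep h); [lra | lra |].
(* Markov's inequality: the deficits [f] are nonnegative with sum at most [h^2], and each vertex
   outside [high_degree h] has deficit above [h]. *)
rewrite -(ler_pM2r h0) -sum1_card natr_sum mulr_suml.
pose f x : R := (2 / 5 * n%:R - (dg setT x)%:R)%R.
have f0 x : (0 <= f x)%R.
  by rewrite subr_ge0 dgE setTI; apply: small_indep; apply: indep_nbh.
apply: (@le_trans _ _ (\sum_x f x)%R).
  rewrite [X in (_ <= X)%R](bigID (mem (~: high_degree h))) /= -[X in (X <= _)%R]addr0.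
  apply: lerD; last by apply: sumr_ge0 => x _.
  by apply: ler_sum => x; rewrite !inE -ltNge mul1r /f; lra.
rewrite sumrB sumr_const -(mulr_natl _ #|_|) -/n; move: dense.
rewrite -hE; lra.
Qed.

End Graph.

Theorem theorem1p2 (R : realType) :
  exists gamma : R, 0 < gamma /\
    forall (n : nat) (V : finType) (adj : rel V),
      #|V| = n ->
      simple_graph adj ->
      triangle_free adj ->
      (1 / 5 - gamma) * n%:R ^+ 2 <= #|edges adj|%:R ->
      exists S : {set V},
        #|S| = (n %/ 2)%N /\
        #|spanned_edges adj S|%:R <= n%:R ^+ 2 / 50 :> R.
Proof.
(* The degree sum is at least twice the number of edges, hence the halving of the constant of
   [dense_half]. *)
exists ((1 / 4000) ^+ 2 / 2); split; first by rewrite divr_gt0 ?exprn_gt0 ?divr_gt0.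
move=> n V adj <- [adjC adj_irr] tri dense.
suff /existsP[S /andP[/eqP cS eS]] : has_half adj.
  exists S; split=> //.
  have := leq_trans (leq_mul (leqnn 25) (spanned_le adjC adj_irr S)) eS.
  rewrite mulnA -(ler_nat R) (natrM _ (25 * 2)) natrX; lra.
apply: (dense_half adjC tri (R := R)).
have := spanned_le adjC adj_irr [set: V].
have -> : spanned_edges adj [set: V] = edges adj.
  by apply/setP => E; rewrite inE subsetT andbT.
rewrite -(ler_nat R) natrM {1}/e2 (eq_bigl predT) => [|x]; last by rewrite inE.
rewrite natr_sum; move: dense; lra.
Qed.
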